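(* Suppose that $F$ is a subequation on a manifold $X$. If local weak comparison holds for $F$ on $X$, then weak comparison holds for $F$ on $X$.
   Context: $J^2(X)\to X$ is the bundle of 2-jets of real functions, $J^2_xu$ the 2-jet of $u$ at $x$. $\mathrm{Sym}^2(T^*X)\subset J^2(X)$ is the subbundle of 2-jets at $x$ of functions with value $0$ and differential $0$ at $x$; $\mathcal P\subset \mathrm{Sym}^2(T^*X)$ is the set of nonnegative forms; $\mathcal N\subset J^2(X)$ is the set of 2-jets of constant functions with value $\le 0$. Sums of subsets are fibrewise. A *subequation* on $X$ is a subset $F\subset J^2(X)$ with (P) $F+\mathcal P\subset F$; (N) $F+\mathcal N\subset F$; (T) $F=\overline{\mathrm{Int}\,F}$, $F_x=\overline{\mathrm{Int}\,F_x}$ and $\mathrm{Int}\,F_x=(\mathrm{Int}\,F)_x$ for all $x$ ($F_x$ is the fibre and $\mathrm{Int}\,F_x$ its interior in $J^2_x(X)$). The *dual* is $\widetilde F=\{J: -J\notin \mathrm{Int}\,F\}$. $\mathrm{USC}(Y)$ is the set of upper semicontinuous functions $Y\to[-\infty,\infty)$. For a subset $F\subset J^2(X)$ and open $Y\subset X$, $u\in F(Y)$ ($u$ is $F$-subharmonic) means $u\in\mathrm{USC}(Y)$ and, for each $x\in Y$ and each $\varphi$ of class $C^2$ near $x$ with $u-\varphi\le0$ near $x$ and $=0$ at $x$, one has $J^2_x\varphi\in F_x$. For compact $K\subset X$, $F(K)=\{u\in\mathrm{USC}(K):u|_{\mathrm{Int}K}\in F(\mathrm{Int}\,K)\}$.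 Fix a metric on the vector bundle $J^2(X)$; for $c>0$, $F^c_x=\{J\in F_x:\mathrm{dist}(J,J^2_x(X)\setminus F_x)\ge c\}$, the distance being in the fibre. *Weak comparison holds for $F$ on $X$* if for every compact $K\subset X$, every $c>0$, and all $u\in F^c(K)$, $v\in\widetilde F(K)$: $u+v\le0$ on $\partial K$ implies $u+v\le0$ on $K$. *Local weak comparison holds for $F$ on $X$* if every $x\in X$ has a neighborhood $U$ such that weak comparison holds for $F$ on $U$. *)

(* Defs.v *)
From HB Require Import structures.
From mathcomp Require Import all_boot all_order all_algebra.
From mathcomp Require Import all_classical all_reals all_analysis.

Set Implicit Arguments.
Unset Strict Implicit.
Unset Printing Implicit Defensive.

Import Order.TTheory GRing.Theory Num.Theory.
Import numFieldNormedType.Exports.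

Local Open Scope classical_set_scope.
Local Open Scope ring_scope.

(** * The space of symmetric matrices *)

Section SymMatrix.
Context {R : realType} {n : nat}.

Definition is_sym : {pred 'M[R]_n} := fun A => A^T == A.

Lemma is_sym_submod_closed : submod_closed is_sym.
Proof.
split=> [|a A B]; rewrite !unfold_in ?trmx0// => /eqP tA /eqP tB.
by rewrite linearD linearZ /= tA tB.
Qed.

HB.instance Definition _ :=
  GRing.isSubmodClosed.Build R 'M[R]_n is_sym is_sym_submod_closed.

Record sym_matrix := SymMatrix { sym_val :> 'M[R]_n; _ : sym_val \in is_sym }.

HB.instance Definition _ := [isSub for sym_val].
HB.instance Definition _ := [Choice of sym_matrix by <:].
HB.instance Definition _ := [SubChoice_isSubLmodule of sym_matrix by <:].
HB.instance Definition _ :=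
  Topological.copy sym_matrix (initial_topology sym_val).

Fact sym_part_subproof (A : 'M[R]_n) : 2^-1 *: (A + A^T) \in is_sym.
Proof. by rewrite unfold_in linearZ linearD /= trmxK addrC. Qed.

Definition sym_part (A : 'M[R]_n) : sym_matrix :=
  SymMatrix (sym_part_subproof A).

End SymMatrix.
Arguments sym_matrix R n : clear implicits.

(** * Functions of class C^k and 2-jets on R^n *)

Section Euclidean.
Context {R : realType} {n : nat}.
Implicit Types (V : set 'rV[R]_n) (f : 'rV[R]_n -> R).

Definition partial (i : 'I_n) f : 'rV[R]_n -> R :=
  fun a => 'D_(delta_mx 0 i) f a.

Fixpoint Ck (k : nat) V f : Prop :=
  if k is k'.+1 then
    (forall a, V a -> differentiable f a) /\ forall i, Ck k' V (partial i f)
  else forall a, V a -> {for a, continuous f}.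

Definition C2_near f (a : 'rV[R]_n) := exists2 V, open_nbhs a V & Ck 2 V f.

Definition smooth_on m V (f : 'rV[R]_n -> 'rV[R]_m) :=
  forall (k : nat) (i : 'I_m), Ck k V (fun a => f a 0 i).

(* The model fibre: value, differential and Hessian in coordinates. *)
Definition jet : Type := (R^o * 'rV[R]_n * sym_matrix R n)%type.

HB.instance Definition _ := GRing.Lmodule.on jet.
HB.instance Definition _ := Topological.on jet.

Definition jval (j : jet) : R := j.1.1.
Definition jgrad (j : jet) : 'rV[R]_n := j.1.2.
Definition jhess (j : jet) : sym_matrix R n := j.2.

(* The symmetrization makes the value a symmetric matrix for every [f]; it has
   no effect at points near which [f] is C^2, the mixed partial derivatives
   being then equal. *)
Definition hessian f (a : 'rV[R]_n) : sym_matrix R n :=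
  sym_part (\matrix_(i, j) partial i (partial j f) a).

Definition jet_of f (a : 'rV[R]_n) : jet :=
  (f a : R^o, \row_i partial i f a, hessian f a).

(* If [j] is the 2-jet of [f] at [psi a], then [jet_pullback psi a j] is the
   2-jet of [f \o psi] at [a], by the chain rule
     d_i d_j (f o psi) = sum_(k, l) (d_k d_l f) (d_i psi_k) (d_j psi_l)
                         + sum_k (d_k f) (d_i d_j psi_k). *)
Definition jet_pullback (psi : 'rV[R]_n -> 'rV[R]_n) (a : 'rV[R]_n) (j : jet)
    : jet :=
  let psi_ k := fun b => psi b 0 k in
  let D : 'M[R]_n := \matrix_(i, k) partial i (psi_ k) a in
  (jval j : R^o,
   jgrad j *m D^T,
   sym_part (D *m sym_val (jhess j) *m D^T)
     + \sum_(k < n) jgrad j 0 k *: hessian (psi_ k) a).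

End Euclidean.
Arguments jet R n : clear implicits.

(** * Smooth manifolds *)

Record chart (R : realType) (n : nat) (X : topologicalType) := Chart {
  dom : set X;
  chart_map :> X -> 'rV[R]_n;
  chart_inv : 'rV[R]_n -> X;
  dom_open : open dom;
  img_open : open (chart_map @` dom);
  chart_mapK : forall x, dom x -> chart_inv (chart_map x) = x;
  chart_map_continuous : {within dom, continuous chart_map};
  chart_inv_continuous : {within chart_map @` dom, continuous chart_inv}
}.

Definition transition_smooth (R : realType) (n : nat) (X : topologicalType)
    (e e' : chart R n X) :=
  smooth_on (e @` (dom e `&` dom e')) (e' \o chart_inv e).

(* [chart_at] selects a chart of the atlas around each point; the fibre of the
   jet bundle at [x] is written in the coordinates of [chart_at x]. *)
Record manifold (R : realType) (n : nat) := Manifold {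
  carrier :> topologicalType;
  manifold_hausdorff : hausdorff_space carrier;
  manifold_second_countable : @second_countable carrier;
  atlas : set (chart R n carrier);
  atlas_smooth : forall e e', atlas e -> atlas e' -> transition_smooth e e';
  chart_at : carrier -> chart R n carrier;
  chart_at_atlas : forall x, atlas (chart_at x);
  chart_at_dom : forall x, dom (chart_at x) x
}.

(** * The bundle of 2-jets *)

Section JetBundle.
Context {R : realType} {n : nat}.

(* [(x, j)] is the jet at [x] whose coordinates in [chart_at x] are [j]. *)
Definition J2 (X : manifold R n) : Type := (X * jet R n)%type.

HB.instance Definition _ (X : manifold R n) := Choice.on (J2 X).

Variable X : manifold R n.
Implicit Types (x : X) (F G : set (J2 X)) (phi : X -> R).

Definition in_chart_at phi x : 'rV[R]_n -> R := phi \o chart_inv (chart_at x).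

Definition C2_at phi x := C2_near (in_chart_at phi x) (chart_at x x).

Definition jet_at phi x : J2 X := (x, jet_of (in_chart_at phi x) (chart_at x x)).

(* The inverse of the local trivialization given by [e]: the point with
   coordinates [p.1] in [e], and the jet there with coordinates [p.2] in [e]. *)
Definition bundle_chart (e : chart R n X) (p : 'rV[R]_n * jet R n) : J2 X :=
  let x := chart_inv e p.1 in
  (x, jet_pullback (e \o chart_inv (chart_at x)) (chart_at x x) p.2).

Definition bundle_chart_preimage (e : chart R n X) (W : set (J2 X)) :
    set ('rV[R]_n * jet R n) :=
  [set p | (e @` dom e) p.1 /\ W (bundle_chart e p)].

Definition J2_open (W : set (J2 X)) :=
  forall e, atlas e -> open (bundle_chart_preimage e W).

Lemma J2_openT : J2_open setT.
Proof.
move=> e _; have -> : bundle_chart_preimage e setT = fst @^-1` (e @` dom e).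
  by apply/seteqP; split=> p //= [].
by apply: open_comp; [move=> p _; exact: cvg_fst|exact: img_open].
Qed.

Lemma J2_openI (V W : set (J2 X)) :
  J2_open V -> J2_open W -> J2_open (V `&` W).
Proof.
move=> oV oW e ae; have -> : bundle_chart_preimage e (V `&` W) =
    bundle_chart_preimage e V `&` bundle_chart_preimage e W.
  by apply/seteqP; split=> p /= => [[? []]|[[? ?] []]].
by apply: openI; [exact: oV|exact: oW].
Qed.

Lemma J2_open_bigU (I : Type) (W : I -> set (J2 X)) :
  (forall i, J2_open (W i)) -> J2_open (\bigcup_i W i).
Proof.
move=> oW e ae; have -> : bundle_chart_preimage e (\bigcup_i W i) =
    \bigcup_i bundle_chart_preimage e (W i).
  by apply/seteqP; split=> p /= => [[? [i]]|[i ? []]]; [exists i|split; last exists i].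
by apply: bigcup_open => i _; exact: oW.
Qed.

HB.instance Definition _ :=
  isOpenTopological.Build (J2 X) J2_openT J2_openI J2_open_bigU.

Definition fiber F x : set (jet R n) := [set j | F (x, j)].

Definition fiberwise_sum F G : set (J2 X) :=
  [set J | exists j k, [/\ F (J.1, j), G (J.1, k) & J.2 = j + k]].

Definition opp_jet (J : J2 X) : J2 X := (J.1, - J.2).

Definition Sym2 : set (J2 X) := [set J | jval J.2 = 0 /\ jgrad J.2 = 0].

Definition nonneg_forms : set (J2 X) :=
  [set J | Sym2 J /\
    forall v : 'rV[R]_n, 0 <= (v *m sym_val (jhess J.2) *m v^T) 0 0].

Definition nonpos_constants : set (J2 X) :=
  [set J | exists2 r : R, r <= 0 & J = jet_at (cst r) J.1].

Record subequation F : Prop := Subequation {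
  subeq_P : fiberwise_sum F nonneg_forms `<=` F;
  subeq_N : fiberwise_sum F nonpos_constants `<=` F;
  subeq_T : F = closure F°;
  subeq_T_fiber : forall x, fiber F x = closure (fiber F x)°;
  subeq_T_int : forall x, (fiber F x)° = fiber F° x
}.

Definition dual F : set (J2 X) := [set J | ~ F° (opp_jet J)].

Record bundle_metric := BundleMetric {
  bm_inner : X -> jet R n -> jet R n -> R;
  bm_linear : forall x (a : R) j1 j2 k,
    bm_inner x (a *: j1 + j2) k = a * bm_inner x j1 k + bm_inner x j2 k;
  bm_sym : forall x j k, bm_inner x j k = bm_inner x k j;
  bm_pos : forall x j, j != 0 -> 0 < bm_inner x j j;
  (* by polarization, the inner product depends continuously on the point *)
  bm_continuous : continuous (fun J : J2 X => bm_inner J.1 J.2 J.2)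
}.

Definition bm_norm (g : bundle_metric) x (j : jet R n) : R :=
  Num.sqrt (bm_inner g x j j).

(* Extended-real valued: the distance to the empty set is [+oo]. *)
Definition bm_dist (g : bundle_metric) x (j : jet R n) (A : set (jet R n))
    : \bar R :=
  ereal_inf [set (bm_norm g x (j - k))%:E | k in A].

Definition strict (g : bundle_metric) F (c : R) : set (J2 X) :=
  [set J | F J /\ (c%:E <= bm_dist g J.1 J.2 (~` fiber F J.1))%E].

(** * Subharmonic functions and weak comparison *)

(* A function on [Y] is represented by a function on [X] of which only the
   values on [Y] are used. *)
Definition usc_on (Y : set X) (u : X -> \bar R) :=
  forall x, Y x -> (u x < +oo)%E /\
    forall a : R, (u x < a%:E)%E ->
      \forall y \near within Y (nbhs x), (u y < a%:E)%E.

(* for open [Y] *)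
Definition subharmonic F (Y : set X) (u : X -> \bar R) :=
  usc_on Y u /\
  forall x, Y x -> forall phi : X -> R, C2_at phi x ->
    (\forall y \near x, (u y - (phi y)%:E <= 0)%E) ->
    (u x - (phi x)%:E = 0)%E ->
    F (jet_at phi x).

(* for compact [K] *)
Definition subharmonic_cpt F (K : set X) (u : X -> \bar R) :=
  usc_on K u /\ subharmonic F K° u.

Definition boundary (K : set X) : set X := closure K `\` K°.

(* For open [U], so that the interior and the boundary in [U] of a compact
   subset of [U] are those in [X]. *)
Definition weak_comparison_on (g : bundle_metric) F (U : set X) :=
  forall K : set X, compact K -> K `<=` U ->
  forall c : R, 0 < c ->
  forall u v : X -> \bar R,
    subharmonic_cpt (strict g F c) K u ->
    subharmonic_cpt (dual F) K v ->
    (forall x, boundary K x -> (u x + v x <= 0)%E) ->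
    forall x, K x -> (u x + v x <= 0)%E.

Definition weak_comparison (g : bundle_metric) F := weak_comparison_on g F setT.

Definition local_weak_comparison (g : bundle_metric) F :=
  forall x, exists2 U, open_nbhs x U & weak_comparison_on g F U.

End JetBundle.

(* Main.v *)
(* At a positive interior maximum [x0] of [u + v], replace [u] by
   [u - eps * |y - y(x0)|^2 - s] in a chart [y], with
   [s = max (u + v) - eps * r^2 >= 0].
   For small [eps] the jets of the perturbation have norm at most [c / 2] near
   [x0], so this function is [F^(c/2)]-subharmonic there, by (N).  Its sum with
   [v] is nonpositive on the boundary of a cube of radius [r] around [x0] and
   positive at [x0], against weak comparison near [x0]. *)
Require Import Defs.
From mathcomp Require Import all_boot all_order all_algebra.
From mathcomp Require Import all_classical all_reals all_analysis.
From mathcomp Require Import ring lra.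

Set Implicit Arguments.
Unset Strict Implicit.
Unset Printing Implicit Defensive.

Import Order.TTheory GRing.Theory Num.Theory.
Import numFieldNormedType.Exports.

Local Open Scope classical_set_scope.
Local Open Scope ring_scope.

(** * Functions of class C^k and their jets *)

(** The first-order expansion at [a] involves only values near [a], so the differential of [f] also
    serves for [g]. *)
Lemma near_eq_differentiable (R : realType) (V W : normedModType R)
    (f g : V -> W) (a : V) :
  (\near a, f a = g a) -> differentiable f a -> differentiable g a.
Proof.
move=> fg df; have [df_cts df_eq] := (diff_locallyP a f).1 df.
have dg_eq : g \o shift a = cst (g a) + 'd f a +o_ 0 id.
  apply/eqaddoP => _/posnumP[e].
  move/eqaddoP : df_eq => /(_ e%:num (gt0 e)).
  have : \forall h \near (0 : V), f (h + a) = g (h + a).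
    by move: fg; rewrite (near_shift 0) /= subr0.
  apply: filterS2 => h /= fgh; rewrite !fctE /= fgh.
  by rewrite (nbhs_singleton fg).
by apply/diff_locallyP; rewrite (diff_unique df_cts dg_eq).
Qed.

Section Jets.
Context {R : realType} {n : nat}.
Implicit Types (V W : set 'rV[R]_n) (f g : 'rV[R]_n -> R) (a : 'rV[R]_n).

Lemma near_eq_partial i f g a :
  (\near a, f a = g a) -> partial i f a = partial i g a.
Proof. exact: near_eq_derive. Qed.

Lemma partialD i f g a : differentiable f a -> differentiable g a ->
  partial i (f \+ g) a = partial i f a + partial i g a.
Proof. by move=> df dg; apply: deriveD; exact: diff_derivable. Qed.

Lemma partialM i f g a : differentiable f a -> differentiable g a ->
  partial i (f \* g) a = f a * partial i g a + g a * partial i f a.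
Proof. by move=> df dg; apply: deriveM; exact: diff_derivable. Qed.

Lemma partial_cst i (c : R) a : partial i (cst c) a = 0.
Proof. exact: derive_cst. Qed.

(* Keeps unification from unfolding the limits defining the derivatives. *)
#[local] Opaque partial.

Lemma Ck_cst k V (c : R) : Ck k V (cst c).
Proof.
elim: k c => [|k IH] c /=; first by move=> a _; exact: cst_continuous.
split=> [a _|i]; first exact: differentiable_cst.
have -> : partial i (cst c) = cst 0 by apply/funext => a; exact: partial_cst.
exact: IH.
Qed.

Lemma CkW k V W f : W `<=` V -> Ck k V f -> Ck k W f.
Proof.
move=> WV; elim: k f => [|k IH] f /=; first by move=> fc a /WV; exact: fc.
by move=> [df Cf]; split=> [a /WV|i]; [exact: df|exact: IH].
Qed.

Lemma Ck_pred k V f : Ck k.+1 V f -> Ck k V f.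
Proof.
elim: k f => [|k IH] f [df Cf].
  by move=> a Va; exact/differentiable_continuous/df.
by split=> // i; apply: IH.
Qed.

(** As [V] is open, agreement on [V] is agreement near each of its points. The partial derivatives
    then agree on [V] too, and induction applies to them. *)
Lemma eq_Ck k V f g : open V -> (forall a, V a -> f a = g a) ->
  Ck k V f -> Ck k V g.
Proof.
move=> oV; have fg_near (h h' : 'rV[R]_n -> R) :
    (forall a, V a -> h a = h' a) ->
    forall a, V a -> \near a, h a = h' a.
  by move=> hh' a Va; apply: filterS (open_nbhs_nbhs (conj oV Va)) => b /hh'.
elim: k f g => [|k IH] f g fg /=.
  move=> fc a Va; rewrite /prop_for /continuous_at -fg//.
  by have /near_eq_cvg/cvg_trans := fg_near _ _ fg a Va; apply; exact: fc.
move=> [df Cf]; split=> [a Va|i].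
  exact: near_eq_differentiable (fg_near _ _ fg a Va) (df a Va).
apply: IH (Cf i) => a Va.
by apply: near_eq_partial; exact: fg_near.
Qed.

Lemma CkD k V f g : open V -> Ck k V f -> Ck k V g -> Ck k V (f \+ g).
Proof.
move=> oV; elim: k f g => [|k IH] f g /=.
  by move=> fc gc a Va; apply: continuousD; [exact: fc|exact: gc].
move=> [df Cf] [dg Cg]; split=> [a Va|i].
  by apply: differentiableD; [exact: df|exact: dg].
apply: eq_Ck oV _ (IH _ _ (Cf i) (Cg i)) => a Va /=.
by rewrite partialD//; [exact: df|exact: dg].
Qed.

Lemma CkM k V f g : open V -> Ck k V f -> Ck k V g -> Ck k V (f \* g).
Proof.
move=> oV; elim: k f g => [|k IH] f g.
  by move=> fc gc a Va; exact: (continuousM (fc a Va) (gc a Va)).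
move=> Cf Cg; have [df pf] := Cf; have [dg pg] := Cg; split=> [a Va|i].
  by apply: differentiableM; [exact: df|exact: dg].
(* Each product pairs a function with a partial derivative; [Ck_pred] lowers the function to order
   [k], so the induction hypothesis covers both products. *)
apply: (@eq_Ck _ _ ((f \* partial i g) \+ (g \* partial i f))) => //.
  by move=> a Va /=; rewrite partialM//; [exact: df|exact: dg].
exact: CkD oV (IH _ _ (Ck_pred Cf) (pg i)) (IH _ _ (Ck_pred Cg) (pf i)).
Qed.

(** Differentiating a first-order rule once more requires it on a whole neighborhood of [a]; this
    supplies one. *)
Lemma C2_nearP f a : C2_near f a -> \forall b \near a, C2_near f b.
Proof.
move=> [V [oV Va] Cf]; apply: filterS (open_nbhs_nbhs (conj oV Va)) => b Vb.
by exists V.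
Qed.

Lemma C2_near_cst c a : C2_near (cst c) a.
Proof. by exists setT; [split=> //; exact: openT|exact: Ck_cst]. Qed.

Lemma C2_nearD f g a : C2_near f a -> C2_near g a -> C2_near (f \+ g) a.
Proof.
move=> [V [oV Va] Cf] [W [oW Wa] Cg]; have oVW := openI oV oW.
exists (V `&` W) => //; apply: CkD => //.
  by apply: CkW Cf => b [].
by apply: CkW Cg => b [].
Qed.

Lemma C2_nearM f g a : C2_near f a -> C2_near g a -> C2_near (f \* g) a.
Proof.
move=> [V [oV Va] Cf] [W [oW Wa] Cg]; have oVW := openI oV oW.
exists (V `&` W) => //; apply: CkM => //.
  by apply: CkW Cf => b [].
by apply: CkW Cg => b [].
Qed.

Lemma C2_near_sum m (f : 'I_m -> 'rV[R]_n -> R) a :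
  (forall l, C2_near (f l) a) -> C2_near (\sum_(l < m) f l) a.
Proof.
move=> Cf; elim/big_ind : _ => [|g h|l _].
  exact: C2_near_cst.
  exact: C2_nearD.
exact: Cf.
Qed.

Lemma C2_near_differentiable f a : C2_near f a -> differentiable f a.
Proof. by move=> [V [oV Va] [df _]]; exact: df. Qed.

Lemma C2_near_partial_differentiable i f a :
  C2_near f a -> differentiable (partial i f) a.
Proof. by move=> [V [oV Va] [_ Cf]]; have [+ _] := Cf i; exact. Qed.

Lemma partial2D i j f g a : C2_near f a -> C2_near g a ->
  partial i (partial j (f \+ g)) a =
  partial i (partial j f) a + partial i (partial j g) a.
Proof.
move=> Cf Cg; rewrite -partialD; [|exact: C2_near_partial_differentiable..].
apply: near_eq_partial; move: (C2_nearP Cf) (C2_nearP Cg).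
by apply: filterS2 => b Cfb Cgb; apply: partialD; exact: C2_near_differentiable.
Qed.

Lemma partial2M i j f g a : C2_near f a -> C2_near g a ->
  partial i (partial j (f \* g)) a =
  f a * partial i (partial j g) a + partial j g a * partial i f a +
  (g a * partial i (partial j f) a + partial j f a * partial i g a).
Proof.
move=> Cf Cg; have df := C2_near_differentiable Cf.
have dg := C2_near_differentiable Cg.
have dpf := C2_near_partial_differentiable j Cf.
have dpg := C2_near_partial_differentiable j Cg.
have pfg : \near a, partial j (f \* g) a =
    ((f \* partial j g) \+ (g \* partial j f)) a.
  move: (C2_nearP Cf) (C2_nearP Cg).
  by apply: filterS2 => b Cfb Cgb; apply: partialM; exact: C2_near_differentiable.
rewrite (near_eq_partial i pfg) partialD; [|exact: differentiableM..].
by rewrite (partialM i df dpg) (partialM i dg dpf).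
Qed.

Lemma jetP (j k : jet R n) :
  jval j = jval k -> (forall l, jgrad j 0 l = jgrad k 0 l) ->
  (forall l m, sym_val (jhess j) l m = sym_val (jhess k) l m) -> j = k.
Proof.
move: j k => [[x y] z] [[x' y'] z']; rewrite /jval /jgrad /jhess /=.
by move=> -> /rowP -> zz'; congr (_, _, _); apply/val_inj/matrixP.
Qed.

Lemma jvalD (j k : jet R n) : jval (j + k) = jval j + jval k.
Proof. by []. Qed.

Lemma jgradDE (j k : jet R n) l : jgrad (j + k) 0 l = jgrad j 0 l + jgrad k 0 l.
Proof. by have -> : jgrad (j + k) = jgrad j + jgrad k by []; rewrite mxE. Qed.

Lemma jhessDE (j k : jet R n) l m : sym_val (jhess (j + k)) l m =
  sym_val (jhess j) l m + sym_val (jhess k) l m.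
Proof.
have -> : sym_val (jhess (j + k)) = sym_val (jhess j) + sym_val (jhess k) by [].
by rewrite mxE.
Qed.

Lemma jgradZE (c : R) (j : jet R n) l : jgrad (c *: j) 0 l = c * jgrad j 0 l.
Proof. by have -> : jgrad (c *: j) = c *: jgrad j by []; rewrite mxE. Qed.

Lemma jhessZE (c : R) (j : jet R n) l m :
  sym_val (jhess (c *: j)) l m = c * sym_val (jhess j) l m.
Proof.
have -> : sym_val (jhess (c *: j)) = c *: sym_val (jhess j) by [].
by rewrite mxE.
Qed.

Lemma jgrad_jet_ofE f a l : jgrad (jet_of f a) 0 l = partial l f a.
Proof. by rewrite /jgrad /jet_of /= mxE. Qed.

Lemma jhess_jet_ofE f a l m : sym_val (jhess (jet_of f a)) l m =
  2^-1 * (partial l (partial m f) a + partial m (partial l f) a).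
Proof. by rewrite /jhess /jet_of /= !mxE. Qed.

Lemma jet_ofD f g a : C2_near f a -> C2_near g a ->
  jet_of (f \+ g) a = jet_of f a + jet_of g a.
Proof.
move=> Cf Cg; apply: jetP => [|l|l m].
- by [].
- rewrite [LHS]jgrad_jet_ofE [RHS]jgradDE.
  rewrite [X in _ = X + _]jgrad_jet_ofE.
  rewrite [X in _ = _ + X]jgrad_jet_ofE.
  by rewrite partialD//; exact: C2_near_differentiable.
- rewrite [LHS]jhess_jet_ofE [RHS]jhessDE.
  rewrite [X in _ = X + _]jhess_jet_ofE [X in _ = _ + X]jhess_jet_ofE.
  by rewrite (partial2D l m Cf Cg) (partial2D m l Cf Cg) addrACA mulrDr.
Qed.

Lemma partial_cstE i (c : R) : partial i (cst c) = (cst 0 : 'rV[R]_n -> R).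
Proof. by apply/funext => b; rewrite partial_cst. Qed.

(** Scaling is treated as a product with a constant function, whose partial derivatives vanish
    identically. *)
Lemma jet_ofZ c f a : C2_near f a -> jet_of (cst c \* f) a = c *: jet_of f a.
Proof.
move=> Cf; have Cc := C2_near_cst c a.
have df := C2_near_differentiable Cf; have dc := C2_near_differentiable Cc.
apply: jetP => [|l|l m].
- by [].
- rewrite [LHS]jgrad_jet_ofE [RHS]jgradZE jgrad_jet_ofE partialM//.
  by rewrite partial_cst mulr0 addr0.
- rewrite [LHS]jhess_jet_ofE [RHS]jhessZE jhess_jet_ofE.
  rewrite (partial2M l m Cc Cf) (partial2M m l Cc Cf).
  rewrite !partial_cstE /=.
  move: (partial l (partial m f) a) (partial m (partial l f) a) => x y; ring.
Qed.

(** The zero function is 0 times itself, so homogeneity applies. *)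
Lemma jet_of_cst0 a : jet_of (cst 0) a = 0.
Proof.
rewrite -(scale0r (jet_of (cst 0) a)) -jet_ofZ; last exact: C2_near_cst.
by congr jet_of; apply/funext => b /=; rewrite mulr0.
Qed.

Lemma jet_of_sum m (f : 'I_m -> 'rV[R]_n -> R) a :
  (forall l, C2_near (f l) a) ->
  jet_of (\sum_(l < m) f l) a = \sum_(l < m) jet_of (f l) a.
Proof.
move=> Cf.
(* Additivity of jets needs the partial sums to be C^2, so regularity is carried through the
   induction. *)
suff [] : jet_of (\sum_(l < m) f l) a = \sum_(l < m) jet_of (f l) a /\
          C2_near (\sum_(l < m) f l) a by [].
elim/big_ind2 : _ => [|x1 x2 y1 y2 [<- ?] [<- ?]|l _].
- by split; [exact: jet_of_cst0|exact: C2_near_cst].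
- by split; [exact: jet_ofD|exact: C2_nearD].
- by split=> //; exact: Cf.
Qed.

End Jets.

(** * The squared distance in a chart *)

Section SquaredDistance.
Context {R : realType} {n : nat}.
#[local] Opaque partial.
Implicit Types (a c p : 'rV[R]_n) (psi : 'rV[R]_n -> 'rV[R]_n).

Lemma jval_sum (I : finType) (j : I -> jet R n) :
  jval (\sum_i j i) = \sum_i jval (j i).
Proof. exact: (big_morph jval jvalD erefl). Qed.

Lemma jgrad_sumE (I : finType) (j : I -> jet R n) l :
  jgrad (\sum_i j i) 0 l = \sum_i jgrad (j i) 0 l.
Proof.
apply: (big_morph (fun k : jet R n => jgrad k 0 l)) => [k k'|].
  exact: jgradDE.
by rewrite /jgrad /= mxE.
Qed.

Lemma jhess_sumE (I : finType) (j : I -> jet R n) l m :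
  sym_val (jhess (\sum_i j i)) l m = \sum_i sym_val (jhess (j i)) l m.
Proof.
apply: (big_morph (fun k : jet R n => sym_val (jhess k) l m)) => [k k'|].
  exact: jhessDE.
by rewrite /jhess /= mxE.
Qed.

Lemma sym_valDE (A B : sym_matrix R n) l m :
  sym_val (A + B) l m = sym_val A l m + sym_val B l m.
Proof.
by have -> : sym_val (A + B) = sym_val A + sym_val B by []; rewrite mxE.
Qed.

Lemma sym_valZE (x : R) (A : sym_matrix R n) l m :
  sym_val (x *: A) l m = x * sym_val A l m.
Proof. by have -> : sym_val (x *: A) = x *: sym_val A by []; rewrite mxE. Qed.

Lemma sym_val_sumE (I : finType) (A : I -> sym_matrix R n) l m :
  sym_val (\sum_i A i) l m = \sum_i sym_val (A i) l m.
Proof.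
apply: (big_morph (fun B : sym_matrix R n => sym_val B l m)) => [B C|].
  exact: sym_valDE.
by rewrite /= mxE.
Qed.

Lemma jgrad_pullbackE psi a j l : jgrad (jet_pullback psi a j) 0 l =
  \sum_k jgrad j 0 k * partial l (fun b => psi b 0 k) a.
Proof.
have -> : jgrad (jet_pullback psi a j) =
  jgrad j *m (\matrix_(i, k) partial i (fun b => psi b 0 k) a)^T by [].
by rewrite mxE; apply: eq_bigr => k _; rewrite !mxE.
Qed.

Lemma jhess_pullbackE psi a j l m :
  let D : 'M[R]_n := \matrix_(i, k) partial i (fun b => psi b 0 k) a in
  let DHD := D *m sym_val (jhess j) *m D^T in
  sym_val (jhess (jet_pullback psi a j)) l m =
  2^-1 * (DHD l m + DHD m l) +
  \sum_k jgrad j 0 k * sym_val (hessian (fun b => psi b 0 k) a) l m.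
Proof.
move=> D DHD.
have -> : jhess (jet_pullback psi a j) = sym_part DHD
  + \sum_k jgrad j 0 k *: hessian (fun b => psi b 0 k) a by [].
rewrite sym_valDE sym_val_sumE; congr (_ + _).
  by rewrite /sym_part /= !mxE.
by apply: eq_bigr => k _; rewrite sym_valZE.
Qed.

Lemma sym_part_scalar (x : R) : sym_val (sym_part (x%:M : 'M[R]_n)) = x%:M.
Proof.
rewrite /= tr_scalar_mx -scalemx1 -scalerDl scalerA; congr (_ *: _).
by rewrite -mulr2n -[x *+ 2]mulr_natl mulKf// pnatr_eq0.
Qed.

(** The Euclidean distance is used because it has a smooth square, unlike the sup norm carried by
    row vectors. *)
Definition sqdist c p : R := \sum_(k < n) (p 0 k - c 0 k) ^+ 2.

(** The 2-jet of [sqdist c] at [p] in closed form, from which continuity in [p] can be read off. *)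
Definition sqdist_jet c p : jet R n :=
  (sqdist c p : R^o, 2 *: (p - c), sym_part 2%:M).

Lemma jgrad_sqdist_jetE c p k :
  jgrad (sqdist_jet c p) 0 k = 2 * (p 0 k - c 0 k).
Proof. by rewrite /jgrad /= !mxE. Qed.

Lemma jhess_sqdist_jet c p : sym_val (jhess (sqdist_jet c p)) = 2%:M.
Proof. exact: sym_part_scalar. Qed.

Lemma sqdist_comp psi c : sqdist c \o psi =
  \sum_(k < n) ((fun b => psi b 0 k) \+ cst (- c 0 k)) \*
               ((fun b => psi b 0 k) \+ cst (- c 0 k)).
Proof. by apply/funext => b; rewrite /= fct_sumE; apply: eq_bigr. Qed.

Lemma C2_near_sqdist psi c a : (forall k, C2_near (fun b => psi b 0 k) a) ->
  C2_near (sqdist c \o psi) a.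
Proof.
move=> Cpsi; rewrite sqdist_comp; apply: C2_near_sum => k.
by apply: C2_nearM; apply: C2_nearD; do ?[exact: C2_near_cst].
Qed.

(** The chain rule for [sqdist c]. As this function is a sum of squares, the sum and product rules
    applied to the shifted coordinates [T k] suffice. *)
Lemma jet_of_sqdist psi c a : (forall k, C2_near (fun b => psi b 0 k) a) ->
  jet_of (sqdist c \o psi) a = jet_pullback psi a (sqdist_jet c (psi a)).
Proof.
move=> Cpsi.
set T := fun k => (fun b => psi b 0 k) \+ cst (- c 0 k).
have CT k : C2_near (T k) a.
  by apply: C2_nearD => //; exact: C2_near_cst.
have partialT k i :
    \near a, partial i (T k) a = partial i (fun b => psi b 0 k) a.
  apply: filterS (C2_nearP (Cpsi k)) => b Cb.
  rewrite partialD ?partial_cst ?addr0//; exact: C2_near_differentiable.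
have partial1T k i := nbhs_singleton (partialT k i).
have partial2T k i j := near_eq_partial i (partialT k j).
have TE k : T k a = psi a 0 k - c 0 k by [].
rewrite sqdist_comp -/T jet_of_sum; last first.
  by move=> k; exact: C2_nearM (CT k) (CT k).
apply: jetP => [|l|l m].
- by rewrite jval_sum; apply: eq_bigr.
- rewrite jgrad_sumE jgrad_pullbackE; apply: eq_bigr => k _.
  have dT := C2_near_differentiable (CT k).
  rewrite jgrad_sqdist_jetE [LHS]jgrad_jet_ofE (partialM l dT dT).
  rewrite (partial1T k l) TE.
  by move: (partial _ _ _) => x; ring.
(* The Hessian of [sqdist c] is twice the identity, so the quadratic term reduces to [D *m D^T], and
   both sides become sums over [k] compared term by term. *)
- rewrite jhess_sumE jhess_pullbackE jhess_sqdist_jet mul_mx_scalar -scalemxAl.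
  have trD (D : 'M[R]_n) i j : (D *m D^T) i j = \sum_k D i k * D j k.
    by rewrite mxE; apply: eq_bigr => k _; rewrite mxE.
  rewrite [X in _ * (X + _)]mxE [X in _ * (_ + X)]mxE -mulrDr.
  rewrite mulKf ?pnatr_eq0//.
  rewrite !trD -big_split -big_split/=.
  apply: eq_bigr => k _; rewrite [LHS]jhess_jet_ofE jgrad_sqdist_jetE.
  rewrite (partial2M l m (CT k) (CT k)) (partial2M m l (CT k) (CT k)).
  rewrite (partial2T k l m) (partial2T k m l) !(partial1T k) TE !mxE.
  move: (partial l _ a) (partial m _ a) => x y.
  move: (partial l _ a) (partial m _ a) => x' y'; by field.
Qed.

End SquaredDistance.

(** * Maxima of upper semicontinuous functions *)

Section ExtendedReals.
Local Open Scope ereal_scope.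

(** Splits a threshold for a sum into thresholds for its terms, as upper semicontinuity of sums
    requires. Finite terms share the slack evenly; a term [-oo] accepts any threshold. *)
Lemma lte_add_split (R : realType) (x y : \bar R) (a : R) :
  x < +oo -> y < +oo -> x + y < a%:E ->
  exists b c : R, [/\ x < b%:E, y < c%:E & (b + c = a)%R].
Proof.
case: x => [x||]//; case: y => [y||]// _ _.
- rewrite -EFinD lte_fin => xya.
  exists (x + (a - (x + y)) / 2)%R, (y + (a - (x + y)) / 2)%R.
  by rewrite !lte_fin; split=> //; lra.
- move=> _; exists (x + 1)%R, (a - (x + 1))%R.
  by rewrite lte_fin ltNyr; split=> //; lra.
- move=> _; exists (a - (y + 1))%R, (y + 1)%R.
  by rewrite lte_fin ltNyr; split=> //; lra.
- by move=> _; exists 0%R, a; rewrite !ltNyr; split=> //; lra.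
Qed.

(* The filter generated by the sets [{z in K | w y <= w z}], for [y] in [K], is
   a maximizing one; were no maximum attained, each [x] in [K] would have a
   neighborhood on which [w] is eventually exceeded along it. *)
Lemma usc_compact_max (R : realType) (X : topologicalType) (K : set X)
    (w : X -> \bar R) :
  compact K -> K !=set0 ->
  (forall x, K x -> w x < +oo /\ forall a : R, w x < a%:E ->
     \forall y \near within K (nbhs x), w y < a%:E) ->
  exists2 x, K x & forall y, K y -> w y <= w x.
Proof.
move=> /compact_near_coveringP cK [x1 Kx1] uscw; apply: contrapT => nomax.
have bigger x : K x -> exists2 y, K y & w x < w y.
  move=> Kx; apply: contrapT => nx; apply: nomax; exists x => // y Ky.
  by rewrite leNgt; apply/negP => xy; apply: nx; exists y.
pose G := filter_from K (fun y => [set z | K z /\ w y <= w z]).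
have FG : Filter G.
  apply: filter_from_filter; first by exists x1.
  move=> y z Ky Kz; have [yz|zy] := leP (w y) (w z).
    by exists z => // t [Kt zt]; split; split=> //; exact: le_trans zt.
  by exists y => // t [Kt yt]; split; split=> //; exact: le_trans (ltW zy) yt.
have [|y Ky GyK] := cK X G (fun z x => K x -> w x < w z) FG.
  move=> x Kx; have [y Ky xy] := bigger x Kx.
  have [wyoo _] := uscw y Ky; have [_ uscx] := uscw x Kx.
  (* Thresholds are real: [w y] is not [+oo] by hypothesis, nor [-oo] since it exceeds [w x]. *)
  have [r wyr] : exists r, w y = r%:E.
    by case: (w y) wyoo xy => [r _ _||_]; [exists r| |rewrite ltNge leNye].
  exists ([set x | K x -> w x < w y], [set z | K z /\ w y <= w z]).
    by split; [rewrite wyr; apply: uscx; rewrite -wyr|exists y].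
  by move=> [x' z] /= [wx' [Kz yz]] /wx'/lt_le_trans; exact.
(* Compactness has made the strict inequality uniform over [K]; taking both points equal to [y]
   gives [w y < w y]. *)
by have := GyK y (conj Ky (lexx _)) y Ky Ky; rewrite ltxx.
Qed.

End ExtendedReals.

(** * Strictness under perturbation of jets *)

Section BundleMetric.
Context {R : realType} {n : nat} {X : manifold R n}.
Variable g : bundle_metric X.
Implicit Types (x : X) (j k : jet R n) (F : set (J2 X)).

Local Notation inner := (bm_inner g).

Lemma bm_innerDl x j k l : inner x (j + k) l = inner x j l + inner x k l.
Proof. by rewrite -[j]scale1r bm_linear mul1r scale1r. Qed.

Lemma bm_inner0l x k : inner x 0 k = 0.
Proof. by apply: (addrI (inner x 0 k)); rewrite -bm_innerDl !addr0. Qed.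

Lemma bm_innerZl x a j k : inner x (a *: j) k = a * inner x j k.
Proof. by rewrite -[a *: j]addr0 bm_linear bm_inner0l addr0. Qed.

Lemma bm_inner_ge0 x j : 0 <= inner x j j.
Proof. by have [->|j0] := eqVneq j 0; [rewrite bm_inner0l|exact/ltW/bm_pos]. Qed.

Lemma bm_inner_sqrD x a j k : inner x (j + a *: k) (j + a *: k) =
  inner x j j + 2 * a * inner x j k + a ^+ 2 * inner x k k.
Proof.
rewrite bm_innerDl bm_innerZl [inner x j (j + _)]bm_sym [inner x k (j + _)]bm_sym.
rewrite !bm_innerDl !bm_innerZl [inner x k j]bm_sym; ring.
Qed.

Lemma bm_Cauchy_Schwarz x j k : inner x j k <= bm_norm g x j * bm_norm g x k.
Proof.
rewrite /bm_norm -sqrtrM ?bm_inner_ge0//.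
have [->|k0] := eqVneq k 0; first by rewrite bm_sym bm_inner0l sqrtr_ge0.
have kk := bm_pos g x k0.
rewrite (le_trans (ler_norm _))// -sqrtr_sqr ler_sqrt; last first.
  by rewrite mulr_ge0 ?bm_inner_ge0.
(* This vector is the component of [j] orthogonal to [k]; multiplying its squared norm by
   [inner x k k] gives the inequality. *)
have := bm_inner_ge0 x (j + (- inner x j k / inner x k k) *: k).
rewrite bm_inner_sqrD -(pmulr_lge0 _ kk).
suff -> : (inner x j j + 2 * (- inner x j k / inner x k k) * inner x j k +
   (- inner x j k / inner x k k) ^+ 2 * inner x k k) * inner x k k =
   inner x j j * inner x k k - inner x j k ^+ 2 by rewrite subr_ge0.
by field; rewrite gt_eqF.
Qed.

Lemma bm_normD x j k : bm_norm g x (j + k) <= bm_norm g x j + bm_norm g x k.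
Proof.
rewrite -(@ler_pXn2r _ 2)// ?nnegrE ?addr_ge0 ?sqrtr_ge0//.
rewrite sqrrD !sqr_sqrtr ?bm_inner_ge0// -{1 2}[k]scale1r bm_inner_sqrD.
rewrite mulr1 expr1n mul1r lerD2r lerD2l -[leRHS]mulr_natl ler_pM2l//.
exact: bm_Cauchy_Schwarz.
Qed.

Lemma bm_normZ x a j : 0 <= a -> bm_norm g x (a *: j) = a * bm_norm g x j.
Proof.
move=> a0; rewrite /bm_norm bm_innerZl bm_sym bm_innerZl mulrA sqrtrM ?mulr_ge0//.
by rewrite -expr2 sqrtr_sqr ger0_norm.
Qed.

(** By the triangle inequality the distance to the complement of the fibre drops by at most [d]; a
    move shorter than [c] cannot leave the fibre. *)
Lemma strict_subl F c d x j k : bm_norm g x k <= d -> d < c ->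
  strict g F c (x, j) -> strict g F (c - d) (x, j - k).
Proof.
move=> kd dc [Fj /= cj].
have dist_ge l : ~ F (x, l) -> c <= bm_norm g x (j - l).
  by move=> Fl; rewrite -lee_fin (le_trans cj)//; apply: ereal_inf_lbound; exists l.
split=> /=.
  apply: contrapT => /dist_ge; rewrite opprB addrCA subrr addr0 => ck.
  by have := le_lt_trans (le_trans ck kd) dc; rewrite ltxx.
apply: le_ereal_inf_tmp => _ [l /dist_ge jl <-]; rewrite lee_fin lerBlDr.
rewrite (le_trans jl)// (le_trans _ (lerD (lexx _) kd))//.
by rewrite (le_trans _ (bm_normD _ _ _))// addrAC subrK.
Qed.

(** By (N), subtracting the jet of [r] maps the complement of the fibre into itself. Hence adding it
    to [j] does not bring [j] closer to that complement. *)
Lemma strict_addN F (c : R) x j (r : R) :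
  fiberwise_sum F (@nonpos_constants R n X) `<=` F -> r <= 0 ->
  strict g F c (x, j) -> strict g F c (x, j + (jet_at (cst r) x).2).
Proof.
move=> FN r0 [Fj /= cj].
have FNr k : F (x, k) -> F (x, k + (jet_at (cst r) x).2).
  by move=> Fk; apply: FN; exists k, (jet_at (cst r) x).2; split=> //; exists r.
split; first exact: FNr.
apply: le_ereal_inf_tmp => _ /= [l Fl <-].
apply: le_trans cj _; apply: ereal_inf_lbound; exists (l - (jet_at (cst r) x).2).
  by move=> /= /FNr; rewrite subrK.
by rewrite opprB addrA [_ - l]addrAC.
Qed.

End BundleMetric.

(** * Charts *)

Section Charts.
Context {R : realType} {n : nat} {X : topologicalType}.
Implicit Types (e : chart R n X) (x : X) (p : 'rV[R]_n).

Lemma chart_continuous e x : dom e x -> {for x, continuous e}.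
Proof.
have := @chart_map_continuous _ _ _ e.
rewrite continuous_open_subspace; last exact: dom_open.
by move=> ce dx; apply: ce; rewrite inE.
Qed.

Lemma chart_inv_continuous_at e p :
  (e @` dom e) p -> {for p, continuous (chart_inv e)}.
Proof.
have := @chart_inv_continuous _ _ _ e.
rewrite continuous_open_subspace; last exact: img_open.
by move=> ce dp; apply: ce; rewrite inE.
Qed.

Lemma chart_invK e p : (e @` dom e) p -> e (chart_inv e p) = p.
Proof. by move=> [x dx <-]; rewrite chart_mapK. Qed.

Lemma dom_chart_inv e p : (e @` dom e) p -> dom e (chart_inv e p).
Proof. by move=> [x dx <-]; rewrite chart_mapK. Qed.

Lemma nbhs_dom e x : dom e x -> nbhs x (dom e).
Proof. by move=> dx; apply: open_nbhs_nbhs; split=> //; exact: dom_open. Qed.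

(** [C2_near] asks for an open set; this is the one on which transition maps are smooth. *)
Lemma open_chart_domI e e' : open (e @` (dom e `&` dom e')).
Proof.
rewrite openE => p [x [dx d'x] <-].
have img : (e @` dom e) (e x) by exists x.
have := chart_inv_continuous_at img.
rewrite /prop_for /continuous_at chart_mapK// => /(_ _ (nbhs_dom d'x)) d'.
apply: filterS2 (open_nbhs_nbhs (conj (@img_open _ _ _ e) img)) d'.
move=> q imgq d'q; exists (chart_inv e q); last exact: chart_invK.
by split=> //; exact: dom_chart_inv.
Qed.

End Charts.

(** * Continuity of the squared distance and of its jet *)

Section SquaredDistanceContinuity.
Context {R : realType} {n : nat}.

Lemma continuous_sqdist (c : 'rV[R]_n) : continuous (sqdist c).
Proof.
move=> p.
have -> : sqdist c = \sum_(k < n) (fun p => (p 0 k - c 0 k) * (p 0 k - c 0 k)).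
  by apply/funext => q; rewrite fct_sumE.
elim/big_ind : _ => [|f h cf ch|k _]; first exact: cst_continuous.
  exact: (continuousD cf ch).
have cB : {for p, continuous (fun p : 'rV[R]_n => p 0 k - c 0 k)}.
  by apply: continuousB; [exact: coord_continuous|exact: cst_continuous].
exact: (continuousM cB cB).
Qed.

Lemma continuous_sqdist_jet (c : 'rV[R]_n) : continuous (sqdist_jet c).
Proof.
move=> p.
have h1 : sqdist c q @[q --> p] --> sqdist c p by exact: continuous_sqdist.
have h2 : 2 *: (q - c) @[q --> p] --> 2 *: (p - c).
  have hB : q - c @[q --> p] --> p - c by exact: (cvgB cvg_id (cvg_cst c)).
  exact: cvgZ (cvg_cst _) hB.
have h3 := @cst_continuous _ _ (sym_part (2%:M : 'M[R]_n)) p.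
exact: (cvg_pair (cvg_pair h1 h2) h3).
Qed.

Lemma continuous_sqdist_jet_graph (c : 'rV[R]_n) :
  continuous (fun p => (p, sqdist_jet c p)).
Proof. by move=> p; exact: (cvg_pair cvg_id (@continuous_sqdist_jet c p)). Qed.

End SquaredDistanceContinuity.

(** * The squared distance as a function on the manifold *)

Section SquaredDistanceOnManifold.
Context {R : realType} {n : nat} {X : manifold R n}.
Variable g : bundle_metric X.
Implicit Types (x : X) (e : chart R n X) (c : 'rV[R]_n).

Lemma C2_transition e x k : atlas e -> dom e x ->
  C2_near (fun b => (e \o chart_inv (chart_at x)) b 0 k) (chart_at x x).
Proof.
move=> ae dx; exists (chart_at x @` (dom (chart_at x) `&` dom e)).
  split; first exact: open_chart_domI.
  by exists x => //; split=> //; exact: chart_at_dom.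
exact: (atlas_smooth (chart_at_atlas x) ae 2%N).
Qed.

Lemma C2_at_sqdist e c x : atlas e -> dom e x -> C2_at (sqdist c \o e) x.
Proof.
move=> ae dx.
apply: (@C2_near_sqdist _ _ (e \o chart_inv (chart_at x))) => k.
exact: C2_transition.
Qed.

(** The left side uses the coordinates of [chart_at x], which may vary wildly with [x]; the right
    side uses the fixed chart [e], where continuity is visible. *)
Lemma jet_at_sqdist e c x : atlas e -> dom e x ->
  jet_at (sqdist c \o e) x = bundle_chart e (e x, sqdist_jet c (e x)).
Proof.
move=> ae dx; rewrite /jet_at /bundle_chart /= chart_mapK//; congr pair.
rewrite (_ : in_chart_at _ _ = sqdist c \o (e \o chart_inv (chart_at x)))//.
rewrite jet_of_sqdist => [|k]; last exact: C2_transition.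
by rewrite /= chart_mapK//; exact: chart_at_dom.
Qed.

Lemma open_bundle_chart_preimage e (W : set (J2 X)) :
  atlas e -> open W -> open (bundle_chart_preimage e W).
Proof. by move=> ae oW; exact: (oW e ae). Qed.

Lemma open_bm_lt (m : R) : open [set J : J2 X | bm_inner g J.1 J.2 J.2 < m].
Proof.
have -> : [set J | bm_inner g J.1 J.2 J.2 < m] =
  (fun J : J2 X => bm_inner g J.1 J.2 J.2) @^-1` [set r | r < m] by [].
by apply: open_comp => [J _|]; [exact: bm_continuous|exact: open_lt].
Qed.

Lemma near_sqdist_jet_graph e c x (P : set ('rV[R]_n * jet R n)) : dom e x ->
  nbhs (e x, sqdist_jet c (e x)) P ->
  \forall y \near x, P (e y, sqdist_jet c (e y)).
Proof.
move=> dx nP.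
have nP2 : \forall p \near e x, P (p, sqdist_jet c p).
  exact: (@continuous_sqdist_jet_graph _ _ c (e x) P nP).
exact: (chart_continuous dx nP2).
Qed.

(** Continuity of the jet section: read in [e], it is the continuous graph of [sqdist_jet c], and
    the topology of [J2 X] is defined through such readings. *)
Lemma near_jet_at_sqdist e c x (W : set (J2 X)) : atlas e -> dom e x ->
  open W -> W (jet_at (sqdist c \o e) x) ->
  \forall y \near x, W (jet_at (sqdist c \o e) y).
Proof.
move=> ae dx oW; rewrite jet_at_sqdist// => Wx.
have oP : nbhs (e x, sqdist_jet c (e x)) (bundle_chart_preimage e W).
  apply: open_nbhs_nbhs; split; first exact: open_bundle_chart_preimage.
  by split=> //; exists x.
apply: filterS2 (nbhs_dom dx) (near_sqdist_jet_graph dx oP).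
by move=> y dy [_ Wy]; rewrite jet_at_sqdist.
Qed.

Lemma sqdist_jet_bounded e c x : atlas e -> dom e x ->
  exists2 M : R, 0 < M &
    \forall y \near x, bm_norm g y (jet_at (sqdist c \o e) y).2 <= M.
Proof.
move=> ae dx; pose q := (jet_at (sqdist c \o e) x).2.
(* The added 1 makes the bound strict at [x], hence an open condition on jets. *)
pose m := bm_inner g x q q + 1.
have m0 : 0 < m by rewrite ltr_wpDl// bm_inner_ge0.
exists (Num.sqrt m); first by rewrite sqrtr_gt0.
have := near_jet_at_sqdist (c := c) ae dx (open_bm_lt (m := m)).
have qm : bm_inner g x q q < m by rewrite ltrDl.
move=> /(_ qm); apply: filterS => y ym.
rewrite /bm_norm ler_sqrt; first exact: ltW ym.
exact: ltW.
Qed.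

End SquaredDistanceOnManifold.

(** * Perturbation of strictly subharmonic functions *)

Section Comparison.
Context {R : realType} {n : nat} {X : manifold R n}.
Variable g : bundle_metric X.
Implicit Types (x : X) (F : set (J2 X)) (Y K : set X) (u v : X -> \bar R).

Lemma usc_onW Y Z u : Y `<=` Z -> usc_on Z u -> usc_on Y u.
Proof.
move=> YZ uscu x /YZ Zx; have [uoo usc] := uscu x Zx; split=> // a /usc.
by rewrite !near_withinE; apply: filterS => y uy /YZ/uy.
Qed.

Lemma usc_onD Y u v : usc_on Y u -> usc_on Y v ->
  usc_on Y (fun x => u x + v x)%E.
Proof.
move=> uscu uscv x Yx; have [uoo uu] := uscu x Yx; have [voo vv] := uscv x Yx.
split=> [|a /lte_add_split-/(_ uoo voo)[b [c [/uu ub /vv vc <-]]]].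
  exact: lte_add_pinfty.
move: ub vc; rewrite EFinD; apply: filterS2 => y; exact: lteD.
Qed.

Lemma usc_on_continuous Y (h : X -> R) :
  (forall x, Y x -> {for x, continuous h}) ->
  usc_on Y (fun x => (h x)%:E).
Proof.
move=> ch x Yx; split=> [|a]; first exact: ltry.
rewrite lte_fin => hxa; apply: cvg_within.
have ha : nbhs (h x) [set r | r < a].
  by apply: open_nbhs_nbhs; split; [exact: open_lt|].
have : \forall y \near x, h y < a by exact: ch x Yx _ ha.
by apply: filterS => y; rewrite lte_fin.
Qed.

Lemma in_chart_atD (f h : X -> R) x :
  in_chart_at (f \+ h) x = in_chart_at f x \+ in_chart_at h x.
Proof. by []. Qed.

Lemma in_chart_atZ (a : R) (f : X -> R) x :
  in_chart_at (cst a \* f) x = cst a \* in_chart_at f x.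
Proof. by []. Qed.

Lemma C2_atD (f h : X -> R) x : C2_at f x -> C2_at h x -> C2_at (f \+ h) x.
Proof. by rewrite /C2_at in_chart_atD; exact: C2_nearD. Qed.

Lemma jet_atD (f h : X -> R) x : C2_at f x -> C2_at h x ->
  (jet_at (f \+ h) x).2 = (jet_at f x).2 + (jet_at h x).2.
Proof. by rewrite /C2_at /jet_at in_chart_atD; exact: jet_ofD. Qed.

Lemma C2_at_cst (r : R) x : C2_at (cst r) x.
Proof. exact: C2_near_cst. Qed.

Lemma C2_atZ (a : R) (f : X -> R) x : C2_at f x -> C2_at (cst a \* f) x.
Proof. by rewrite /C2_at in_chart_atZ; apply: C2_nearM; exact: C2_near_cst. Qed.

Lemma jet_atZ (a : R) (f : X -> R) x : C2_at f x ->
  (jet_at (cst a \* f) x).2 = a *: (jet_at f x).2.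
Proof. by rewrite /C2_at /jet_at in_chart_atZ; exact: jet_ofZ. Qed.

Lemma jet_at_cst0 x : (jet_at (cst 0) x).2 = 0.
Proof. exact: jet_of_cst0. Qed.

(** If [phi] tests the perturbed function at [x], then [phi + h + s] tests [u] there. Recovering the
    jet of [phi] means subtracting that of [h], at a cost of [d], and adding that of the constant
    [- s], at no cost by (N). *)
Lemma subharmonic_strict_perturb F Y u (h : X -> R) (s c d : R) :
  fiberwise_sum F (@nonpos_constants R n X) `<=` F ->
  0 <= s -> d < c ->
  (forall x, Y x -> C2_at h x /\ bm_norm g x (jet_at h x).2 <= d) ->
  usc_on Y (fun x => u x + (- (h x + s))%:E)%E ->
  subharmonic (strict g F c) Y u ->
  subharmonic (strict g F (c - d)) Y (fun x => u x + (- (h x + s))%:E)%E.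
Proof.
move=> FN s0 dc hY usch [uscu subu]; split=> // x Yx phi Cphi le0 eq0.
have [Ch hd] := hY x Yx.
have Chs : C2_at (h \+ cst s) x by exact: C2_atD Ch (C2_at_cst s x).
have := subu x Yx (phi \+ (h \+ cst s)) (C2_atD Cphi Chs).
have shift y : (u y - ((phi \+ (h \+ cst s)) y)%:E =
                u y + (- (h y + s))%:E - (phi y)%:E)%E.
  by rewrite -EFinN -[in RHS]EFinN -addeA -EFinD /= opprD [(- phi y + _)%R]addrC.
have test1 : \forall y \near x, (u y - ((phi \+ (h \+ cst s)) y)%:E <= 0)%E.
  by apply: filterS le0 => y; rewrite shift.
move=> /(_ test1); rewrite shift => /(_ eq0) Fphi.
have cst0 : (jet_at (cst s \+ cst (- s)) x).2 = 0.
  have -> : cst s \+ cst (- s) = cst 0 :> (X -> R).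
    by apply/funext => y /=; rewrite subrr.
  exact: jet_at_cst0.
have jets (j1 j2 j3 j4 j5 j6 : jet R n) : j2 = j1 + j3 -> j3 = j4 + j5 ->
    0 = j5 + j6 -> j1 = j2 + j6 - j4.
  by move=> -> -> j56; rewrite -!addrA [j5 + _]addrA -j56 add0r subrr addr0.
have jphi := jets _ _ _ _ _ _ (jet_atD Cphi Chs) (jet_atD Ch (C2_at_cst s x))
  (etrans (esym cst0) (jet_atD (C2_at_cst s x) (C2_at_cst (- s) x))).
have -> : jet_at phi x = (x, (jet_at phi x).2) by [].
rewrite jphi; apply: strict_subl hd dc (strict_addN FN _ Fphi).
by rewrite oppr_le0.
Qed.

End Comparison.

(** * Localization at an interior maximum *)

Section Maximum.
Context {R : realType} {n : nat} {X : manifold R n}.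
Variable g : bundle_metric X.
Implicit Types (x : X) (e : chart R n X) (F : set (J2 X)) (K U : set X).

Lemma compact_box (c : 'rV[R]_n) (r : R) :
  compact [set p : 'rV[R]_n | forall k, `|p 0 k - c 0 k| <= r].
Proof.
have -> : [set p : 'rV[R]_n | forall k, `|p 0 k - c 0 k| <= r] =
  [set p | forall k, `[c 0 k - r, c 0 k + r]%classic (p ord0 k)].
  apply/seteqP; split=> p /= box k; have := box k;
  by rewrite in_itv /= ler_distl.
apply: (@rV_compact R n (fun k => `[c 0 k - r, c 0 k + r]%classic)) => k.
exact: segment_compact.
Qed.

(** [B] is a closed coordinate cube, that is, a closed sup-norm ball. On its boundary some
    coordinate is at least [r] away from the center, which bounds the Euclidean distance below. *)
Lemma chart_cube_nbhs e x (G : set X) : dom e x -> nbhs x G ->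
  exists (B : set X) (r : R), [/\ compact B, B `<=` G, B x, 0 < r &
    forall y, boundary B y -> r ^+ 2 <= sqdist (e x) (e y)].
Proof.
move=> dx nG; have img : (e @` dom e) (e x) by exists x.
have nG' : nbhs (chart_inv e (e x)) G by rewrite chart_mapK.
have n1 : nbhs (e x) (e @` dom e).
  by apply: open_nbhs_nbhs; split=> //; exact: img_open.
have n2 : \forall p \near e x, G (chart_inv e p).
  exact: (chart_inv_continuous_at img nG').
have : \forall p \near e x, (e @` dom e) p /\ G (chart_inv e p).
  by apply: filterS2 n1 n2.
move=> /nbhs_ballP[r0 /= r0_gt0 ballG].
(* Halving fits the closed cube inside the open ball of radius [r0]. *)
pose r := r0 / 2; have r_gt0 : 0 < r by rewrite divr_gt0.
pose box := [set p : 'rV[R]_n | forall k, `|p 0 k - e x 0 k| <= r].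
have boxG p : box p -> (e @` dom e) p /\ G (chart_inv e p).
  move=> pbox; apply: ballG; split=> // i k; rewrite ord1 /ball /= distrC.
  by rewrite (le_lt_trans (pbox k))// /r ltr_pdivrMr// ltr_pMr// ltr1n.
have cB : compact (chart_inv e @` box).
  apply: continuous_compact (@compact_box (e x) r).
  apply: continuous_subspaceW (@chart_inv_continuous _ _ _ e).
  by move=> p /boxG[].
exists (chart_inv e @` box), r; split=> //.
- by move=> _ [p /boxG[_ ?] <-].
- by exists (e x); rewrite ?chart_mapK// => k; rewrite subrr normr0 ltW.
move=> y [+ nint]; rewrite -(closure_id _).1; last first.
  exact: compact_closed (@manifold_hausdorff _ _ X) cB.
move=> [p pbox py]; have [imgp _] := boxG p pbox.
have ey : e y = p by rewrite -py chart_invK.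
have dy : dom e y by rewrite -py; exact: dom_chart_inv.
(* Otherwise [e y] lies in the open cube, whose preimage under [e] is a neighborhood of [y] inside
   [B], and [y] is interior. *)
have [k rk] : exists k, r <= `|p 0 k - e x 0 k|.
  apply: contrapT => /forallNP small; apply: nint.
  have small' k : `|p 0 k - e x 0 k| < r by rewrite ltNge; apply/negP/small.
  have nb : nbhs (e y) (ball (e x) r).
    apply: open_nbhs_nbhs; split; first exact: ball_open.
    by split=> // i k; rewrite ord1 ey /ball /= distrC.
  have := chart_continuous dy nb; apply: filterS2 (nbhs_dom dy) => z dz [_ zr].
  exists (e z); last exact: chart_mapK.
  by move=> k; rewrite distrC; exact/ltW/zr.
rewrite ey /sqdist (bigD1 k)//= -[leLHS]addr0 lerD//.
  rewrite -[leRHS]real_normK ?num_real//.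
  by apply: lerXn2r => //; rewrite nnegrE ltW.
by apply: sumr_ge0 => i _; exact: sqr_ge0.
Qed.

Lemma ereal_add_gt0 (x y : \bar R) : (x < +oo)%E -> (y < +oo)%E ->
  (0 < x + y)%E -> exists a b : R, [/\ x = a%:E, y = b%:E & 0 < a + b].
Proof.
by case: x => [a||]//; case: y => [b||]// _ _ ab; exists a, b.
Qed.

Lemma no_interior_max F K (c : R) (u v : X -> \bar R) (x0 : X) :
  subequation F -> local_weak_comparison g F -> 0 < c ->
  subharmonic_cpt (strict g F c) K u -> subharmonic_cpt (dual F) K v ->
  K° x0 -> (0 < u x0 + v x0)%E ->
  ~ (forall x, K x -> (u x + v x <= u x0 + v x0)%E).
Proof.
move=> [_ FN _ _ _] lwc c0 [uscu subu] [uscv subv] Kx0 pos max.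
have Kx0' := interior_subset Kx0.
have [a0 [b0 [ua vb ab]]] := ereal_add_gt0 (uscu x0 Kx0').1 (uscv x0 Kx0').1 pos.
set m := a0 + b0 in ab.
have uvm x : K x -> (u x + v x <= m%:E)%E.
  by move=> /max; rewrite ua vb -EFinD.
have [U [oU Ux0] wcU] := lwc x0.
set e := chart_at x0; have ae : atlas e := chart_at_atlas x0.
have dx0 : dom e x0 := chart_at_dom x0.
pose psi := sqdist (e x0) \o e.
have [M M0 nM] := sqdist_jet_bounded g (e x0) ae dx0.
(* Here weak comparison is available, [u] and [v] are subharmonic, and [psi] is C^2 with bounded
   jets. *)
pose G := [set x | [/\ U x, K° x, dom e x & bm_norm g x (jet_at psi x).2 <= M]].
have nG : nbhs x0 G.
  have nU : nbhs x0 U by apply: open_nbhs_nbhs.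
  have nK : nbhs x0 K° by apply: open_nbhs_nbhs; split=> //; exact: open_interior.
  have nUK : \forall x \near x0, U x /\ K° x by exact: filterI.
  have ndM : \forall x \near x0, dom e x /\ bm_norm g x (jet_at psi x).2 <= M.
    by apply: filterI nM; exact: nbhs_dom.
  by apply: filterS2 nUK ndM => x [? ?] [? ?]; split.
have [B [r [cB BG Bx0 r0 Br]]] := chart_cube_nbhs dx0 nG.
have r2 : 0 < r ^+ 2 by rewrite exprn_gt0.
(* The first bound keeps the jets of [eps * psi] within [c / 2]; the second makes [s]
   nonnegative. *)
pose eps := Num.min (c / 2 / M) (m / r ^+ 2).
have eps0 : 0 < eps by rewrite lt_min !divr_gt0.
pose s := m - eps * r ^+ 2.
have s0 : 0 <= s.
  by rewrite subr_ge0 -ler_pdivlMr// ge_min lexx orbT.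
pose h := cst eps \* psi.
have hB x : B x -> C2_at h x /\ bm_norm g x (jet_at h x).2 <= c / 2.
  move=> /BG[_ _ dx xM]; have Cpsi : C2_at psi x := C2_at_sqdist (e x0) ae dx.
  split; first exact: C2_atZ.
  rewrite (jet_atZ eps Cpsi) bm_normZ; last exact: ltW.
  rewrite (le_trans (ler_wpM2l (ltW eps0) xM))//.
  by rewrite -ler_pdivlMr// ge_min lexx.
pose u' x := (u x + (- (h x + s))%:E)%E.
have BK : B `<=` K° by move=> x /BG[].
have BK' : B `<=` K by move=> x /BK; exact: interior_subset.
have BiK : B° `<=` K° by move=> x /interior_subset/BK.
have chB x : B x -> {for x, continuous (fun x => - (h x + s))}.
  move=> /BG[_ _ dx _].
  have cpsi : {for x, continuous psi}.
    by apply: continuous_comp; [exact: chart_continuous|exact: continuous_sqdist].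
  apply: continuousN; apply: continuousD; last exact: cst_continuous.
  by apply: continuousM => //; exact: cst_continuous.
have uscu' : usc_on B u'.
  exact: usc_onD (usc_onW BK' uscu) (usc_on_continuous chB).
have subu' : subharmonic_cpt (strict g F (c - c / 2)) B u'.
  split=> //; apply: subharmonic_strict_perturb => //.
  - by rewrite ltr_pdivrMr// ltr_pMr// ltr1n.
  - by move=> x /interior_subset/hB.
  - exact: usc_onW (@interior_subset _ B) uscu'.
  - by split=> [|x /BiK Kx]; [exact: usc_onW BiK subu.1|exact: subu.2].
have subv' : subharmonic_cpt (dual F) B v.
  split; first exact: usc_onW BK' uscv.
  by split=> [|x /BiK Kx]; [exact: usc_onW BiK subv.1|exact: subv.2].
have c2 : 0 < c - c / 2 by lra.
have u'v x : (u' x + v x = u x + v x + (- (h x + s))%:E)%E by rewrite /u' addeAC.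
have BU : B `<=` U by move=> x /BG[].
have bd x : boundary B x -> (u' x + v x <= 0)%E.
  move=> bx; have Bx : B x.
    rewrite (closure_id B).1; first by case: bx.
    exact: compact_closed (@manifold_hausdorff _ _ X) cB.
  rewrite u'v.
  have := Br x bx => rx.
  (* On the boundary [psi] is at least [r ^+ 2], so the subtracted quantity reaches the maximum
     [m]. *)
  have hm : m <= h x + s by rewrite /s addrCA lerDl subr_ge0 /h /= ler_pM2l.
  apply: (@le_trans _ _ (m%:E + (- (h x + s))%:E)%E).
    by rewrite leeD2r// uvm//; exact: BK'.
  by rewrite -EFinD lee_fin subr_le0.
(* At [x0] the function [h] vanishes and the perturbed sum is [m - s = eps * r ^+ 2 > 0],
   contradicting comparison on [B]. *)
have := wcU B cB BU _ c2 u' v subu' subv' bd x0 Bx0.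
rewrite u'v ua vb -!EFinD lee_fin -/m.
have -> : h x0 = 0.
  by rewrite /h /psi /= /sqdist big1 ?mulr0// => k _; rewrite subrr expr0n.
by rewrite add0r /s opprB addrC subrK leNgt mulr_gt0.
Qed.

End Maximum.

Theorem theorem8p3 (R : realType) (n : nat) (X : manifold R n)
    (g : bundle_metric X) (F : set (J2 X)) :
  subequation F -> local_weak_comparison g F -> weak_comparison g F.
Proof.
move=> subF lwc K cK _ c c0 u v subu subv bdK x Kx.
have uscuv := usc_onD subu.1 subv.1.
have [|x0 Kx0 max] := usc_compact_max cK _ uscuv; first by exists x.
apply: le_trans (max x Kx) _; rewrite leNgt; apply/negP => pos.
(* A positive maximum cannot sit on the boundary by hypothesis, so it is interior, since [K] lies in
   its closure. *)
have [bx0|nbx0] := pselect (boundary K x0); first by rewrite ltNge bdK in pos.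
have Kx0i : K° x0.
  by apply: contrapT => nKx0; apply: nbx0; split=> //; exact: subset_closure.
exact: no_interior_max subF lwc c0 subu subv Kx0i pos max.
Qed.
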